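(* A curve $(q(t),p(t),\psi(t))$ in $\mathcal{PC}$ satisfies the no-slip condition $\psi(t)q'(t)=p'(t)$ (for all $t$) if and only if $(q(t),p(t))$ is a null curve in $(M^4,[\mathbf g])$ (equivalently, $(q(t),p(t))$ satisfies the dancing condition: at each moment $t$, the point $q(t)$ is moving towards the turning point $p^*(t)$ of the line $p(t)$).
   Context: $\mathbb{RP}^2=\mathbb P(\mathbb R^3)$, $\mathbb{RP}^{2*}=\mathbb P((\mathbb R^3)^* )$ (the set of lines in $\mathbb{RP}^2$); columns $\mathbf q\in\mathbb R^3$, rows $\mathbf p\in(\mathbb R^3)^*$, $\mathbf p\mathbf q=p_iq^i$; the point $[\mathbf q]$ lies on the line $[\mathbf p]$ iff $\mathbf p\mathbf q=0$. $M^4\subset\mathbb{RP}^2\times\mathbb{RP}^{2*}$ is the set of non-incident point-line pairs. Projective contact: for $(q,p)\in M^4$ there is a natural projective isomorphism $\Psi_{q,p}:\mathbb P(T_q\mathbb{RP}^2)\to\mathbb P(T_p\mathbb{RP}^{2*})$ obtained by identifying $\mathbb P(T_q\mathbb{RP}^2)$ with the lines through $q$, identifying $\mathbb P(T_p\mathbb{RP}^{2*})$ with the points of the line $p$ (a point of $p$ corresponds to the pencil of lines through it, a line in $\mathbb{RP}^{2*}$ through $p$), and sending a line $\ell$ through $q$ to the point $\ell\cap p$. A projective contact element is a triple $(q,p,\psi)$ with $(q,p)\in M^4$ and $\psi:T_q\mathbb{RP}^2\to T_p\mathbb{RP}^{2*}$ a linear isomorphism whose projectivization is $\Psi_{q,p}$.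 $\mathcal{PC}$ is the space of all projective contact elements. Let $Q^5=\{\mathbf p\mathbf q=1\}\subset\mathbb R^3\oplus(\mathbb R^3)^*$ carry the restriction of the flat metric $-2\,d\mathbf p\,d\mathbf q$. The dancing metric $\mathbf g$ is the unique pseudo-riemannian metric on $M^4$ (signature $(2,2)$) for which $Q^5\to M^4$, $(\mathbf q,\mathbf p)\mapsto([\mathbf q],[\mathbf p])$, is a pseudo-riemannian submersion; $[\mathbf g]$ is its conformal class. A curve is null if its velocity is $\mathbf g$-null. Dancing condition in detail: a curve $(q(t),p(t))=([\mathbf q(t)],[\mathbf p(t)])$ of non-incident pairs satisfies it if for each $t$ with $q'(t)\ne0$ and $p'(t)\neq0$ the turning point $p^*(t)=[\mathbf p\times\mathbf p']$ of the line $p(t)$ lies on the tangent line $q^*(t)=[\mathbf q\times\mathbf q']$ (when $q'(t)$ or $p'(t)$ vanishes the condition holds by definition), where $(\mathbf v\times\mathbf w)_i=\epsilon_{ijk}v^jw^k$ on $\mathbb R^3$ and $(\mathbf v\times\mathbf w)^i=\epsilon^{ijk}v_jw_k$ on $(\mathbb R^3)^*$.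
   Formalization: As stated, null ⇒ no-slip fails for a given ψ (replace ψ by 2ψ). Proved: no-slip implies null for every curve in PC; conversely, if q' and p' never vanish, a null (q,p) admits some smooth ψ in PC satisfying no-slip. Null ⇔ dancing is proved for all curves. *)

(* Defs.v *)
From HB Require Import structures.
From mathcomp Require Import all_boot all_order all_algebra.
From mathcomp Require Import all_classical all_reals all_analysis.
From mathcomp Require Import ring.

Set Implicit Arguments.
Unset Strict Implicit.
Unset Printing Implicit Defensive.

Import Order.TTheory GRing.Theory Num.Theory.
Import numFieldNormedType.Exports.

Local Open Scope classical_set_scope.
Local Open Scope ring_scope.

(** Points of RP^2 and of its dual are given by homogeneous coordinates:
    nonzero columns [q] and nonzero rows [p].  Curves are given by smooth
    homogeneous lifts defined on an open interval. *)

Section Tangent.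
Variables (R : realType) (V : lmodType R).

(* [dpi q v] is the image of [v] under the differential at [q] of
   V \ {0} -> P(V).  Tangent vectors of P(V) are encoded as the corresponding
   classes of pairs (base point, vector): since d(pi)_q has kernel R q and
   d(pi)_(a q) (a v) = d(pi)_q v, one has d(pi)_q v = d(pi)_q' v' iff
   (q', v') = (a q, a v + b q) for some a != 0 and b. *)
Definition dpi (q v : V) : set (V * V) :=
  [set x | exists a b : R, a != 0 /\ x = (a *: q, a *: v + b *: q)].

(* The tangent space at [q] of P(V); it only depends on the class of [q]. *)
Definition tangent_space (q : V) : set (set (V * V)) := range (dpi q).

Lemma dpiP (q v q' v' : V) :
  dpi q v = dpi q' v' <->
  exists a b : R, a != 0 /\ (q' = a *: q /\ v' = a *: v + b *: q).
Proof.
split=> [e|[a [b [a0 [-> ->]]]]].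
  have : dpi q v (q', v').
    rewrite e; exists 1, 0; split; first exact: oner_neq0.
    by rewrite !scale1r scale0r addr0.
  by case=> a [b [a0 [-> ->]]]; exists a, b.
apply/seteqP; split=> x [c [d [c0 ->]]].
  exists (c / a), ((d - c / a * b) / a); split.
    by rewrite mulf_neq0 ?invr_eq0.
  by rewrite scalerDr !scalerA -addrA -scalerDl !divfK // addrCA subrr addr0.
exists (c * a), (c * b + d * a); split; first by rewrite mulf_neq0.
by rewrite scalerDr !scalerA -addrA -scalerDl.
Qed.

End Tangent.

Section Velocity.
Variables (R : realType) (V : normedModType R).

(* Smoothness on an open set [I] of parameters. *)
Definition smooth_on (I : set R) (f : R -> V) :=
  forall (n : nat) (t : R), I t -> derivable (f^`(n))%classic t 1.

(* The velocity of the curve [c] in P(V); it is unchanged when the lift [c] is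
   replaced by [a c], since (a c)' = a c' + a' c. *)
Definition velocity (c : R -> V) (t : R) : set (V * V) := dpi (c t) ((c^`())%classic t).

Definition moving (c : R -> V) (t : R) := velocity c t <> dpi (c t) 0.

End Velocity.

Section Dancing.
Variable R : realType.
Local Notation vec := 'cV[R]_3.
Local Notation covec := 'rV[R]_3.

Definition pairing (p : covec) (q : vec) : R := (p *m q) 0 0.

(* Cross products with values in the dual space; indices are modulo 3, so that
   these are epsilon_ijk v^j w^k and epsilon^ijk v_j w_k. *)
Definition crossv (v w : vec) : covec :=
  \row_(i < 3) (v (i + 1) 0 * w (i + 2) 0 - v (i + 2) 0 * w (i + 1) 0).
Definition crossc (v w : covec) : vec :=
  \col_(i < 3) (v 0 (i + 1) * w 0 (i + 2) - v 0 (i + 2) * w 0 (i + 1)).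

(* The point [q] lies on the line [p]. *)
Definition incident (q : vec) (p : covec) := pairing p q = 0.

(* [(q, p)] represents an element of M^4; this forces q and p to be nonzero. *)
Definition inM (q : vec) (p : covec) := pairing p q != 0.

Definition M_curve (I : set R) (q : R -> vec) (p : R -> covec) :=
  [/\ smooth_on I q, smooth_on I p & forall t, I t -> inM (q t) (p t)].

(** Projective contact elements *)

Definition tangent_linear (q : vec) (p : covec)
    (psi : set (vec * vec) -> set (covec * covec)) :=
  forall (a : R) (v1 v2 : vec) (w1 w2 : covec),
    psi (dpi q v1) = dpi p w1 -> psi (dpi q v2) = dpi p w2 ->
    psi (dpi q (a *: v1 + v2)) = dpi p (a *: w1 + w2).

Definition tangent_iso (q : vec) (p : covec)
    (psi : set (vec * vec) -> set (covec * covec)) :=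
  set_bij (tangent_space q) (tangent_space p) psi /\ tangent_linear q p psi.

(* Psi_(q,p) maps the direction [v] at [q] to the direction [w] at [p]: the
   direction [v] is the line l = [crossv q v] through q, the direction [w] is
   the pencil of lines through the point [crossc p w] of p, and that point is
   the intersection of l and p. *)
Definition Psi_rel (q : vec) (p : covec) (v : vec) (w : covec) :=
  incident (crossc p w) (crossv q v) /\ incident (crossc p w) p.

(* Only the restriction of [psi] to the tangent space at [q] is relevant. *)
Definition contact_element (q : vec) (p : covec)
    (psi : set (vec * vec) -> set (covec * covec)) :=
  [/\ inM q p, tangent_iso q p psi &
      forall (v : vec) (w : covec), dpi q v <> dpi q 0 ->
        psi (dpi q v) = dpi p w -> Psi_rel q p v w].

(* A smooth curve in PC: [psi] is induced by a smooth family of linear maps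
   R^3 -> (R^3)^*, given by matrices acting on columns. *)
Definition PC_curve (I : set R) (q : R -> vec) (p : R -> covec)
    (psi : R -> set (vec * vec) -> set (covec * covec)) :=
  [/\ M_curve I q p,
      forall t, I t -> contact_element (q t) (p t) (psi t) &
      exists A : R -> 'M[R]_3, smooth_on I A /\
        forall t (v : vec), I t ->
          psi t (dpi (q t) v) = dpi (p t) ((A t *m v)^T)].

Definition no_slip (I : set R) (q : R -> vec) (p : R -> covec)
    (psi : R -> set (vec * vec) -> set (covec * covec)) :=
  forall t, I t -> psi t (velocity q t) = velocity p t.

(** The dancing metric *)

(* The bilinear form of the flat metric -2 dp dq. *)
Definition flat (x y : vec * covec) : R :=
  - (pairing x.2 y.1 + pairing y.2 x.1).

Definition inQ (q : vec) (p : covec) := pairing p q = 1.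

Definition tangentQ (q : vec) (p : covec) (x : vec * covec) :=
  pairing x.2 q + pairing p x.1 = 0.

Definition projM (q : vec) (p : covec) (x : vec * covec) :
    set (vec * vec) * set (covec * covec) := (dpi q x.1, dpi p x.2).

Definition vertical (q : vec) (p : covec) (x : vec * covec) :=
  tangentQ q p x /\ projM q p x = projM q p 0.

Definition horizontal (q : vec) (p : covec) (x : vec * covec) :=
  tangentQ q p x /\ forall y, vertical q p y -> flat x y = 0.

(* [g], a function of two vectors tangent to M^4 at the same point, makes
   Q^5 -> M^4 a pseudo-riemannian submersion.  As the differential of this map
   sends the horizontal space isomorphically onto the tangent space of M^4,
   this determines [g] on every tangent space of M^4 and makes it a
   nondegenerate symmetric bilinear form there. *)
Definition dancing_metric
    (g : set (vec * vec) * set (covec * covec) ->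
         set (vec * vec) * set (covec * covec) -> R) :=
  forall q p x y, inQ q p -> horizontal q p x -> horizontal q p y ->
    g (projM q p x) (projM q p y) = flat x y.

(* For any metric conformal to [g] the null curves are the same. *)
Definition null_curve
    (g : set (vec * vec) * set (covec * covec) ->
         set (vec * vec) * set (covec * covec) -> R)
    (I : set R) (q : R -> vec) (p : R -> covec) :=
  forall t, I t ->
    g (velocity q t, velocity p t) (velocity q t, velocity p t) = 0.

Lemma pairingDr p q q' : pairing p (q + q') = pairing p q + pairing p q'.
Proof. by rewrite /pairing mulmxDr mxE. Qed.
Lemma pairingDl p p' q : pairing (p + p') q = pairing p q + pairing p' q.
Proof. by rewrite /pairing mulmxDl mxE. Qed.
Lemma pairingZr p a q : pairing p (a *: q) = a * pairing p q.
Proof. by rewrite /pairing -scalemxAr mxE. Qed.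
Lemma pairingZl p a q : pairing (a *: p) q = a * pairing p q.
Proof. by rewrite /pairing -scalemxAl mxE. Qed.
Definition pairingE := (pairingDr, pairingDl, pairingZr, pairingZl).

Lemma horizontalP q p x : inQ q p -> horizontal q p x <->
  pairing p x.1 = 0 /\ pairing x.2 q = 0.
Proof.
rewrite /inQ /horizontal /tangentQ => pq; split=> [[tx hx]|[e1 e2]].
  have vy : vertical q p (q, -1 *: p).
    split; first by rewrite /tangentQ /= !pairingE pq mulN1r addNr.
    congr (_, _); apply/dpiP; [exists 1, (-1) | exists 1, 1];
      (split; [exact: oner_neq0|split; rewrite ?scale1r //=]).
      by rewrite scaleN1r subrr.
    by rewrite scaleN1r addNr.
  have := hx _ vy; rewrite /flat /= !pairingE => e.
  have e2 : pairing p x.1 = pairing x.2 q.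
    by apply/eqP; rewrite -subr_eq0; apply/eqP; rewrite -e; ring.
  have : pairing x.2 q *+ 2 = 0 by rewrite mulr2n -{2}e2.
  by move/eqP; rewrite mulrn_eq0 /= => /eqP e3; rewrite e2.
split=> [|[v w] [_]]; first by rewrite e1 e2 addr0.
rewrite /projM => -[/= /dpiP [a [b [a0 [Ea /= Eb]]]] /dpiP [c [d [c0 [Ec /= Ed]]]]].
have hv : v = (- b / a) *: q.
  apply: (scalerI a0); rewrite scalerA mulrC divfK //.
  by apply/eqP; rewrite scaleNr -addr_eq0 -Eb.
have hw : w = (- d / c) *: p.
  apply: (scalerI c0); rewrite scalerA mulrC divfK //.
  by apply/eqP; rewrite scaleNr -addr_eq0 -Ed.
by rewrite /flat /= hv hw !pairingE e1 e2 !mulr0 addr0 oppr0.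
Qed.

Lemma dancing_metric_exists : exists g, dancing_metric g.
Proof.
pose S X Y : set R := [set r | exists q p x y, [/\ inQ q p, horizontal q p x,
  horizontal q p y & [/\ X = projM q p x, Y = projM q p y & r = flat x y]]].
exists (fun X Y => xget 0 (S X Y)) => q p x y hQ hx hy.
have hS : S (projM q p x) (projM q p y) (flat x y) by exists q, p, x, y.
case: (xgetI 0 hS) => q' [p'] [x'] [y'] [hQ' hx' hy' [[X1 X2] [Y1 Y2] ->]].
move/(horizontalP _ hQ): hx => [hx1 hx2]; move/(horizontalP _ hQ): hy => [hy1 hy2].
move/(horizontalP _ hQ'): hx' => [hx1' hx2'].
move/(horizontalP _ hQ'): hy' => [hy1' hy2'].
have pq : pairing p q = 1 := hQ.
have q0 : q != 0.
  by apply/eqP => E; move: pq; rewrite E /pairing mulmx0 mxE => /eqP; rewrite eq_sym oner_eq0.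
have p0 : p != 0.
  by apply/eqP => E; move: pq; rewrite E /pairing mul0mx mxE => /eqP; rewrite eq_sym oner_eq0.
have [a [b [a0 [Eq Ex1]]]] := (dpiP _ _ _ _).1 X1.
have [a2 [b2 [_ [Eq2 Ey1]]]] := (dpiP _ _ _ _).1 Y1.
have [c [d [c0 [Ep Ex2]]]] := (dpiP _ _ _ _).1 X2.
have [c2 [d2 [_ [Ep2 Ey2]]]] := (dpiP _ _ _ _).1 Y2.
have ea : a2 = a.
  by apply/eqP; rewrite -subr_eq0 -[_ == 0]orbF -(negPf q0) -scaler_eq0 scalerBl -Eq -Eq2 subrr.
have ec : c2 = c.
  by apply/eqP; rewrite -subr_eq0 -[_ == 0]orbF -(negPf p0) -scaler_eq0 scalerBl -Ep -Ep2 subrr.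
have ca : c * a = 1 by rewrite -hQ' Eq Ep !pairingE pq mulr1 mulrC.
subst a2 c2.
move: hx1' hx2' hy1' hy2'; rewrite Ex1 Ex2 Ey1 Ey2 Ep Eq !pairingE hx1 hx2 hy1 hy2 pq.
rewrite !mulr0 !add0r !mulr1 => /eqP hb /eqP hd /eqP hb2 /eqP hd2.
move: hb hd hb2 hd2; rewrite !mulf_eq0 (negPf a0) (negPf c0) /= ?orbF.
move=> /eqP hb /eqP hd /eqP hb2 /eqP hd2.
rewrite /flat Ex1 Ex2 Ey1 Ey2 hb hd hb2 hd2 !scale0r !addr0 !pairingE !mulrA.
by rewrite [a * c]mulrC ca !mul1r.
Qed.

(** The dancing condition *)

Definition dancing (I : set R) (q : R -> vec) (p : R -> covec) :=
  forall t, I t -> moving q t -> moving p t ->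
    incident (crossc (p t) ((p^`())%classic t)) (crossv (q t) ((q^`())%classic t)).

End Dancing.

(* Main.v *)
Require Import Defs.
From HB Require Import structures.
From mathcomp Require Import all_boot all_order all_algebra.
From mathcomp Require Import all_classical all_reals all_analysis.
From mathcomp Require Import ring.

Set Implicit Arguments.
Unset Strict Implicit.
Unset Printing Implicit Defensive.

Import Order.TTheory GRing.Theory Num.Theory.
Import numFieldNormedType.Exports.

Local Open Scope classical_set_scope.
Local Open Scope ring_scope.

(** On horizontal lifts the dancing metric is -2 dp dq, and by the Lagrange identity
    (p x p')(q x q') = (p q)(p' q') - (p q')(p' q) a velocity is null iff the
    turning point of p lies on the tangent line of q; this incidence is also what
    the projective contact condition says about no-slip velocities.
    Conversely, if q and p both move along a null curve, the covector
    p' - (p' q / p q) p annihilates q and q', hence equals c (q x q') for a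
    smooth nowhere zero function c.  The maps v |-> c (q x v) then induce the
    required contact isomorphisms. *)

(** * Cross product identities in dimension three *)

Section Cross.
Variable R : realType.
Implicit Types (q v : 'cV[R]_3) (p w : 'rV[R]_3).

Lemma sum3 (F : 'I_3 -> R) : \sum_(i < 3) F i = F 0 + F 1 + F 2.
Proof.
by rewrite !big_ord_recl big_ord0 addr0 addrA; congr (F _ + F _ + F _);
  apply/val_inj.
Qed.

Lemma pairing3 p q : pairing p q = p 0 0 * q 0 0 + p 0 1 * q 1 0 + p 0 2 * q 2 0.
Proof. by rewrite /pairing mxE sum3. Qed.

Lemma ord3P (P : 'I_3 -> Prop) : P 0 -> P 1 -> P 2 -> forall i, P i.
Proof.
by move=> P0 P1 P2 [[|[|[|//]]] h]; [move: P0|move: P1|move: P2];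
  congr P; apply/val_inj.
Qed.

Lemma ord3E : ((0 + 1 = 1 :> 'I_3)%R * (0 + 2 = 2 :> 'I_3)%R *
  (1 + 1 = 2 :> 'I_3)%R * (1 + 2 = 0 :> 'I_3)%R *
  (2 + 1 = 0 :> 'I_3)%R * (2 + 2 = 1 :> 'I_3)%R)%type.
Proof. by do !split; apply/val_inj. Qed.

Lemma pairing_crossv_crossc q v p w :
  pairing (crossv q v) (crossc p w) =
  pairing p q * pairing w v - pairing p v * pairing w q.
Proof. by rewrite !pairing3 !mxE !ord3E; ring. Qed.

Lemma crossc_crossv p q v :
  crossc p (crossv q v) = pairing p v *: q - pairing p q *: v.
Proof.
by apply/matrixP => i j; rewrite (ord1 j); move: i; apply: ord3P;
  rewrite !pairing3 !mxE !ord3E; ring.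
Qed.

Lemma crossv_crossc q p w :
  crossv q (crossc p w) = pairing w q *: p - pairing p q *: w.
Proof.
by apply/matrixP => j i; rewrite (ord1 j); move: i; apply: ord3P;
  rewrite !pairing3 !mxE !ord3E; ring.
Qed.

Lemma pairing_crossvl q v : pairing (crossv q v) q = 0.
Proof. by rewrite !pairing3 !mxE !ord3E; ring. Qed.

Lemma pairing_crossvr q v : pairing (crossv q v) v = 0.
Proof. by rewrite !pairing3 !mxE !ord3E; ring. Qed.

Lemma pairing_crosscl p w : pairing p (crossc p w) = 0.
Proof. by rewrite !pairing3 !mxE !ord3E; ring. Qed.

Lemma crossc_crossvv q v w :
  crossc (crossv q v) w = pairing w q *: v - pairing w v *: q.
Proof.
by apply/matrixP => i j; rewrite (ord1 j); move: i; apply: ord3P;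
  rewrite !pairing3 !mxE !ord3E; ring.
Qed.

Lemma crossvDZr q a v1 v2 :
  crossv q (a *: v1 + v2) = a *: crossv q v1 + crossv q v2.
Proof.
by apply/matrixP => j i; rewrite (ord1 j); move: i; apply: ord3P;
  rewrite !mxE !ord3E; ring.
Qed.

(** The skew-symmetric matrix of the cross product with [q]; it puts the contact maps in the matrix
    form that [PC_curve] asks for. *)
Definition hat q : 'M[R]_3 := \matrix_(i, j) crossv q (delta_mx j 0) 0 i.

Lemma mul_hat q v : (hat q *m v)^T = crossv q v.
Proof.
by apply/matrixP => j i; rewrite (ord1 j); move: i; apply: ord3P;
  rewrite !mxE sum3 !mxE !ord3E /=; ring.
Qed.

(** A sum of three real squares; this lets the squared norm of [q] x [q'] serve as a denominator. *)
Lemma pairing_tr_eq0 w : pairing w w^T = 0 -> w = 0.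
Proof.
rewrite pairing3 !mxE => /eqP.
rewrite paddr_eq0 ?addr_ge0 ?sqr_ge0 // paddr_eq0 ?sqr_ge0 //.
rewrite !mulf_eq0 !orbb => /andP[/andP[/eqP h0 /eqP h1] /eqP h2].
by apply/matrixP => j; rewrite (ord1 j); apply: ord3P; rewrite mxE.
Qed.

End Cross.

(** * Smoothness on an open set: products, inverses, matrix entries *)

Section Smoothness.
Variables (R : realType) (I : set R).
Hypothesis oI : open I.

Lemma smooth_on_derive1 (V : normedModType R) (f : R -> V) :
  smooth_on I f -> smooth_on I ((f^`())%classic : R -> V).
Proof. by move=> sf n t It; rewrite -derive1Sn; exact: sf. Qed.

Lemma eq_on_derive1 (V : normedModType R) (f g : R -> V) :
  {in I, f =1 g} -> {in I, (f^`())%classic =1 (g^`())%classic}.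
Proof.
move=> fg t tI; rewrite !derive1E; apply: near_eq_derive.
have : nbhs t I by apply: open_nbhs_nbhs; split => //; exact: set_mem.
by apply: filterS => s /mem_set; exact: fg.
Qed.

Lemma eq_on_derivable (V : normedModType R) (f g : R -> V) :
  {in I, f =1 g} -> forall t, I t -> derivable f t 1 -> derivable g t 1.
Proof.
move=> fg t It; apply: near_eq_derivable.
have : nbhs t I by apply: open_nbhs_nbhs.
by apply: filterS => s /mem_set; exact: fg.
Qed.

(** By induction on [n], the [n]-th derivative agrees on [I] with some member of [P], and members of
    [P] are derivable on [I]. *)
Lemma smooth_on_coind (V : normedModType R) (P : (R -> V) -> Prop) :
  (forall f, P f -> (forall t, I t -> derivable f t 1) /\
     exists2 g, P g & {in I, (f^`())%classic =1 g}) ->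
  forall f, P f -> smooth_on I f.
Proof.
move=> hP f Pf n.
have [g Pg fg] : exists2 g, P g & {in I, (f^`(n))%classic =1 g}.
  elim: n => [|n [g Pg fg]]; first by exists f.
  have [_ [h Ph gh]] := hP _ Pg; exists h => // t tI.
  by rewrite derive1nS (eq_on_derive1 fg tI) gh.
move=> t It; apply: (@eq_on_derivable V g) => //.
  by move=> s sI; rewrite fg.
by have [+ _] := hP _ Pg; exact.
Qed.

(* The derivative of an element of this class is, on [I], again in the class,
   which gives smoothness of products and inverses without Leibniz' formula for
   the higher derivatives. *)
Inductive smooth_expr : (R -> R^o) -> Prop :=
| SmoothLeaf f : @smooth_on R R^o I f -> smooth_expr f
| SmoothAdd f g : smooth_expr f -> smooth_expr g -> smooth_expr (f \+ g)
| SmoothMul f g : smooth_expr f -> smooth_expr g ->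
    smooth_expr (fun t => f t * g t : R)
| SmoothInv f : (forall t, I t -> f t != 0) -> smooth_expr f ->
    smooth_expr (fun t => (f t : R)^-1).

Lemma smooth_on_cst (V : normedModType R) (a : V) :
  smooth_on I (fun=> a : V).
Proof.
move=> n t _; suff [b ->] : exists b : V,
    ((fun=> a : V) : R -> V)^`(n)%classic = fun=> b by exact: derivable_cst.
elim: n => [|n [b IHn]]; first by exists a.
exists 0; rewrite derive1nS IHn; apply/funext => s; exact: derive1_cst.
Qed.

Lemma smooth_expr_cst (a : R) : smooth_expr (fun=> a).
Proof. apply: SmoothLeaf; exact: (@smooth_on_cst R^o a). Qed.

Lemma smooth_expr_on f : smooth_expr f -> @smooth_on R R^o I f.
Proof.
move: f; apply: smooth_on_coind => f.
elim=> {f} [f sf|f g _ [df [f' Pf ff]] _ [dg [g' Pg gg]]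
  |f g Sf [df [f' Pf ff]] Sg [dg [g' Pg gg]]|f f0 Sf [df [f' Pf ff]]].
- split; first exact: (sf 0%N).
  by exists (f^`())%classic => //; exact/SmoothLeaf/smooth_on_derive1.
- split=> [t It|]; first by apply: derivableD; [exact: df|exact: dg].
  exists (f' \+ g'); first exact: SmoothAdd.
  move=> t tI; have It := set_mem tI.
  rewrite derive1E deriveD; [|exact: df|exact: dg].
  by rewrite -!derive1E ff ?gg.
- split=> [t It|]; first by apply: derivableM; [exact: df|exact: dg].
  exists ((fun t => f t * g' t) \+ (fun t => g t * f' t)).
    by apply: SmoothAdd; apply: SmoothMul.
  move=> t tI; have It := set_mem tI.
  rewrite derive1E (@deriveM R R f g); [|exact: df|exact: dg].
  by rewrite -!derive1E ff ?gg.
- split=> [t It|]; first by apply: derivableV; [exact: f0|exact: df].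
  (* This is -f'/f^2, written so that it visibly stays in the class. *)
  exists (fun t => (-1) * ((f t)^-1 * (f t)^-1 * f' t)).
    apply: SmoothMul; first exact: smooth_expr_cst.
    by apply: SmoothMul => //; apply: SmoothMul; exact: SmoothInv.
  move=> t tI; have It := set_mem tI.
  rewrite derive1E (@deriveV R R); [|exact: f0|exact: df].
  by rewrite -derive1E ff // mulN1r scaleNr -expr2 exprVn.
Qed.

Lemma smooth_on_mxP m n (M : R -> 'M[R]_(m, n)) :
  smooth_on I M <-> forall i j, smooth_on I (fun t => M t i j : R^o).
Proof.
(* Differentiating entrywise requires the matrix derivative to exist; either hypothesis provides
   this, so one induction serves both directions. *)
have E k t i j : smooth_on I M \/ (forall i j, smooth_on I (fun t => M t i j : R^o)) ->
    I t -> ((M^`(k))%classic : R -> 'M[R]_(m, n)) t i j = ((fun t => M t i j : R^o)^`(k))%classic t.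
  move=> h; elim: k t i j => [//|k IH] t i j It.
  have dM : derivable (M^`(k))%classic t 1.
    case: h => [|h]; first exact.
    apply/derivable_mxP => a b.
    apply: (@eq_on_derivable R^o ((fun t => M t a b : R^o)^`(k))%classic) => //.
      by move=> s sI /=; rewrite IH //; exact: set_mem.
    exact: h.
  rewrite !derive1nS derive1E derive_mx // mxE -derive1E.
  apply: eq_on_derive1 => [s sI|]; last exact/mem_set.
  by rewrite IH //; exact: set_mem.
split=> h.
  move=> i j k t It.
  apply: (@eq_on_derivable R^o (fun t => (M^`(k))%classic t i j)) => //.
    by move=> s sI; apply: E; [left|exact: set_mem].
  by have /derivable_mxP := h k t It.
move=> k t It; apply/derivable_mxP => i j.
apply: (@eq_on_derivable R^o ((fun t => M t i j : R^o)^`(k))%classic) => //.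
  by move=> s sI /=; rewrite E //; [right|exact: set_mem].
exact: h.
Qed.

End Smoothness.

(** * Null tangent vectors and contact maps *)

Section NullVectors.
Variable R : realType.
Implicit Types (q v : 'cV[R]_3) (p w : 'rV[R]_3).

Lemma pairingNr p q : pairing p (- q) = - pairing p q.
Proof. by rewrite /pairing mulmxN mxE. Qed.

Lemma pairingNl p q : pairing (- p) q = - pairing p q.
Proof. by rewrite /pairing mulNmx mxE. Qed.

Definition pairing_linE := (pairingE, pairingNr, pairingNl).

Lemma inM_neq0 q p : inM q p -> q != 0 /\ p != 0.
Proof.
rewrite /inM => N; split; apply: contra_neq N => ->; rewrite /pairing.
  by rewrite mulmx0 mxE.
by rewrite mul0mx mxE.
Qed.

(** A fixed nonzero base vector forces the scale in [dpi] to be 1; only the kernel R [q] of the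
    differential remains. *)
Lemma dpi_eqP (V : lmodType R) (q v v' : V) : q != 0 ->
  dpi q v = dpi q v' <-> exists b : R, v' = v + b *: q.
Proof.
move=> q0; split=> [/dpiP[a [b [_ [qa ->]]]]|[b ->]]; last first.
  by apply/dpiP; exists 1, b; rewrite oner_neq0 !scale1r.
have a1 : a = 1.
  apply/eqP; rewrite -subr_eq0 -[_ == 0]orbF -(negPf q0) -scaler_eq0.
  by rewrite scalerBl scale1r -qa subrr.
by exists b; rewrite a1 scale1r.
Qed.

Lemma dpi_eq0P (V : lmodType R) (q v : V) : q != 0 ->
  dpi q v = dpi q 0 <-> exists b : R, v = b *: q.
Proof.
move=> q0; split=> [/esym /(dpi_eqP _ _ q0)[b ->]|[b ->]].
  by exists b; rewrite add0r.
by apply/esym/(dpi_eqP _ _ q0); exists b; rewrite add0r.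
Qed.

Lemma dancing_metric_sqr g q p v w : dancing_metric g -> inM q p ->
  g (dpi q v, dpi p w) (dpi q v, dpi p w) =
  - 2 * pairing (crossv q v) (crossc p w) / pairing p q ^+ 2.
Proof.
rewrite /inM => hg N0; set N := pairing p q.
(* The horizontal lift at the point ([q]/N, [p]) of Q^5: [v] is rescaled along with [q], and the
   components along [q] and [p] are removed. *)
pose x := (N^-1 *: (v - (pairing p v / N) *: q), w - (pairing w q / N) *: p).
have hQ : inQ (N^-1 *: q) p by rewrite /inQ pairingE mulVf.
have hx : horizontal (N^-1 *: q) p x.
  apply/horizontalP => //; rewrite /x /= !pairing_linE -/N.
  by split; field.
have <- : projM (N^-1 *: q) p x = (dpi q v, dpi p w).
  congr (_, _); apply/esym/dpiP.
    exists N^-1, (- (N^-1 * (pairing p v / N))); split; first by rewrite invr_eq0.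
    by split=> //=; rewrite scalerBr scalerA scaleNr.
  exists 1, (- (pairing w q / N)); split; first exact: oner_neq0.
  by rewrite !scale1r /x /= scaleNr.
rewrite hg // /flat /x /= !pairing_linE pairing_crossv_crossc -/N.
by field.
Qed.

Lemma dancing_metric_null g q p v w : dancing_metric g -> inM q p ->
  g (dpi q v, dpi p w) (dpi q v, dpi p w) = 0 <->
  incident (crossc p w) (crossv q v).
Proof.
move=> hg hM; rewrite dancing_metric_sqr // /incident.
split=> [/eqP|->]; last by rewrite mulr0 mul0r.
rewrite !mulf_eq0 invr_eq0 expf_eq0 /= (negPf hM) oppr_eq0 pnatr_eq0 !orbF.
by move/eqP.
Qed.

(** A zero velocity means that [v] is a multiple of [q], or [w] of [p], so a cross product
    degenerates. This covers the moments at which [dancing] asks nothing. *)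
Lemma incident_still q p v w : inM q p ->
  dpi q v = dpi q 0 \/ dpi p w = dpi p 0 -> incident (crossc p w) (crossv q v).
Proof.
move=> /inM_neq0[q0 p0]; rewrite /incident pairing_crossv_crossc.
case=> [/(dpi_eq0P _ q0)[b ->]|/(dpi_eq0P _ p0)[b ->]];
  by rewrite !pairingE; ring.
Qed.

(** If [q] x [v] vanished, expanding [p] x ([q] x [v]) would give [v] as a multiple of [q], since
    [pairing p q] is nonzero. *)
Lemma crossv_neq0 q p v : inM q p -> dpi q v <> dpi q 0 -> crossv q v != 0.
Proof.
move=> hM; have [q0 _] := inM_neq0 hM; move=> mv; apply/eqP => u0.
apply: mv; apply/dpi_eq0P => //; exists (pairing p v / pairing p q).
have := crossc_crossv p q v; rewrite u0 /crossc.
rewrite [LHS](_ : _ = 0); last by apply/matrixP => i j; rewrite !mxE !mulr0 subrr.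
move/esym/eqP; rewrite subr_eq0 => /eqP e.
by rewrite mulrC -scalerA e scalerA mulVf // scale1r.
Qed.

(* Up to a multiple of [p], the covector [w] is orthogonal to [q], and the
   incidence makes it orthogonal to [v] as well. *)
Lemma incident_crossv q p v w : inM q p -> dpi q v <> dpi q 0 ->
  incident (crossc p w) (crossv q v) ->
  let u := crossv q v in let w' := w - (pairing w q / pairing p q) *: p in
  w' = (pairing w' u^T / pairing u u^T) *: u.
Proof.
move=> hM mv inc u w'.
have e : pairing p q * pairing w v - pairing p v * pairing w q = 0.
  by rewrite -pairing_crossv_crossc.
have uu0 : pairing u u^T != 0.
  by apply/negP => /eqP /pairing_tr_eq0 /eqP; apply/negP; exact: crossv_neq0 hM mv.
have w'q : pairing w' q = 0.
  by rewrite /w' !pairing_linE; field.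
have w'v : pairing w' v = 0.
  apply: (mulfI hM); rewrite /w' !pairing_linE mulr0 -e.
  by field.
(* Here [u] x [w'] vanishes because [w'] annihilates [q] and [v]; crossing it with [u^T] then yields
   the proportionality of [w'] and [u]. *)
have := crossv_crossc u^T u w'; rewrite crossc_crossvv w'q w'v !scale0r subrr.
rewrite [LHS](_ : _ = 0); last by apply/matrixP => i j; rewrite !mxE !mulr0 subrr.
move/esym/eqP; rewrite subr_eq0 => /eqP e'.
by rewrite mulrC -scalerA e' scalerA mulVf // scale1r.
Qed.

(* A class of tangent vectors has no canonical representative; [xget] chooses
   one, which is harmless when [B q] is a multiple of [p].  Sets that are not
   tangent vectors get a junk value. *)
Definition tangent_map q p (B : 'M[R]_3) (X : set ('cV[R]_3 * 'cV[R]_3)) :=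
  dpi p ((B *m xget 0 [set v | X = dpi q v])^T).

(** Another representative differs from [v] by a multiple of [q], which the cross product with [q]
    kills. *)
Lemma tangent_map_hat q p c v : q != 0 ->
  tangent_map q p (c *: hat q) (dpi q v) = dpi p (c *: crossv q v).
Proof.
move=> q0; rewrite /tangent_map.
have /= /(dpi_eqP _ _ q0)[b ->] :=
  @xgetI _ 0 [set v' | dpi q v = dpi q v'] v erefl.
rewrite -scalemxAl linearZ /= mul_hat addrC crossvDZr.
rewrite [crossv q q](_ : _ = 0) ?scaler0 ?add0r //.
by apply/matrixP => i j; rewrite !mxE mulrC subrr.
Qed.

Lemma contact_element_hat q p c : inM q p -> c != 0 ->
  contact_element q p (tangent_map q p (c *: hat q)).
Proof.
move=> hM c0; have [q0 p0] := inM_neq0 hM.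
split=> //; last first.
  move=> v w mv; rewrite tangent_map_hat // => /(dpi_eqP _ _ p0)[b ->].
  rewrite /Psi_rel /incident pairing_crosscl; split=> //.
  rewrite pairing_crossv_crossc !pairingE pairing_crossvl pairing_crossvr.
  by ring.
split; last first.
  move=> a v1 v2 w1 w2; rewrite !tangent_map_hat //.
  move=> /(dpi_eqP _ _ p0)[b1 ->] /(dpi_eqP _ _ p0)[b2 ->].
  apply/dpi_eqP => //; exists (a * b1 + b2).
  rewrite crossvDZr !scalerDr scalerDl !scalerA [c * a]mulrC.
  by rewrite addrACA.
split.
- move=> _ [v _ <-]; rewrite tangent_map_hat //.
  by exists (c *: crossv q v).
- move=> X Y /set_mem[v _ <-] /set_mem[v' _ <-].
  rewrite !tangent_map_hat // => /(dpi_eqP _ _ p0)[b e].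
  (* Pairing with [q] kills both cross products and leaves b ([p] [q]) = 0. *)
  have b0 : b = 0.
    have := congr1 (fun r => pairing r q) e; rewrite /= !pairingE !pairing_crossvl.
    by rewrite !mulr0 add0r => /esym/eqP; rewrite mulf_eq0 (negPf hM) orbF => /eqP.
  have {}e : crossv q v' = crossv q v.
    by apply: (scalerI c0); rewrite e b0 scale0r addr0.
  apply/dpi_eqP => //; exists (pairing p (v' - v) / pairing p q).
  have [/(dpi_eq0P _ q0)[b' e']|/(crossv_neq0 hM)/eqP []] :=
    pselect (dpi q (v' - v) = dpi q 0).
    by rewrite e' pairingE mulfK // -e' addrC subrK.
  by rewrite addrC -scaleN1r crossvDZr scaleN1r e addNr.
- move=> _ [w _ <-].
  (* Since [q] x ([p] x [w]) = ([w] [q]) [p] - ([p] [q]) [w], this factor returns [w] modulo [p]. *)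
  pose v := - (c * pairing p q)^-1 *: crossc p w.
  exists (dpi q v); first by exists v.
  rewrite tangent_map_hat //; apply/dpi_eqP => //.
  exists (pairing w q / pairing p q).
  have -> : crossv q v = - (c * pairing p q)^-1 *: crossv q (crossc p w).
    rewrite /v -[_ *: crossc p w]addr0 crossvDZr [crossv q 0](_ : _ = 0) ?addr0 //.
    by apply/matrixP => i j; rewrite !mxE !mulr0 subrr.
  rewrite crossv_crossc scalerA scalerBr !scalerA.
  have N0 : pairing p q != 0 := hM.
  have -> : c * - (c * pairing p q)^-1 * pairing p q = -1 by field; rewrite c0 N0.
  have -> : c * - (c * pairing p q)^-1 * pairing w q = - (pairing w q / pairing p q).
    by field; rewrite c0 N0.
  by rewrite scaleN1r opprK scaleNr addrAC addNr add0r.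
Qed.

End NullVectors.

(** * No-slip, null and dancing curves *)

Theorem theorem1p6 (R : realType)
    (g : set ('cV[R]_3 * 'cV[R]_3) * set ('rV[R]_3 * 'rV[R]_3) ->
         set ('cV[R]_3 * 'cV[R]_3) * set ('rV[R]_3 * 'rV[R]_3) -> R)
    (hg : dancing_metric g)
    (I : set R) (oI : open I) (iI : is_interval I)
    (q : R -> 'cV[R]_3) (p : R -> 'rV[R]_3) (hM : M_curve I q p) :
  [/\ forall psi : R -> set ('cV[R]_3 * 'cV[R]_3) -> set ('rV[R]_3 * 'rV[R]_3),
        PC_curve I q p psi -> no_slip I q p psi -> null_curve g I q p,
      (forall t, I t -> moving q t /\ moving p t) ->
        ((exists psi : R -> set ('cV[R]_3 * 'cV[R]_3) ->
                       set ('rV[R]_3 * 'rV[R]_3),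
            PC_curve I q p psi /\ no_slip I q p psi) <->
         null_curve g I q p)
    & null_curve g I q p <-> dancing I q p].
Proof.
have [sq sp hN] := hM.
pose v t := (q^`())%classic t; pose w t := (p^`())%classic t.
pose inc t := incident (crossc (p t) (w t)) (crossv (q t) (v t)).
have nullP : null_curve g I q p <-> forall t, I t -> inc t.
  by split=> h t It; apply/(dancing_metric_null _ _ hg (hN t It)); exact: h.
have slip psi : PC_curve I q p psi -> no_slip I q p psi -> null_curve g I q p.
  move=> [_ hc _] hs; apply/nullP => t It; have [_ _ hPsi] := hc t It.
  have [qs|qm] := pselect (dpi (q t) (v t) = dpi (q t) 0).
    by apply: incident_still (hN t It) _; left.
  by have [] := hPsi _ _ qm (hs t It).
split; first exact: slip.
(* A linear bijection [psi] excludes moments at which just one of [q], [p] is still, although such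
   velocities are null; hence both are assumed to move. *)
- move=> mv; split=> [[psi [hPC hs]]|/nullP hinc]; first exact: slip hPC hs.
  pose u t := crossv (q t) (v t).
  pose w' t := w t - (pairing (w t) (q t) / pairing (p t) (q t)) *: p t.
  (* Euclidean projection onto [u] recovers the factor in [w'] = [c] [u] by a formula that is
     visibly smooth. *)
  pose c t := pairing (w' t) (u t)^T / pairing (u t) (u t)^T.
  have w'E t : I t -> w' t = c t *: u t.
    by move=> It; have [qm _] := mv t It; exact: incident_crossv (hN t It) qm (hinc t It).
  have dpi_w' t : I t -> dpi (p t) (w' t) = dpi (p t) (w t).
    move=> It; have [_ p0] := inM_neq0 (hN t It).
    apply/dpi_eqP => //; exists (pairing (w t) (q t) / pairing (p t) (q t)).
    by rewrite /w' subrK.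
  (* If [c] vanished, [p] would be still. *)
  have c0 t : I t -> c t != 0.
    move=> It; have [_ pm] := mv t It; apply/eqP => ct; apply: pm.
    by rewrite /velocity -/(w t) -dpi_w' // w'E // ct scale0r.
  exists (fun t => tangent_map (q t) (p t) (c t *: hat (q t))).
  split; last first.
    move=> t It; have [q0 _] := inM_neq0 (hN t It).
    by rewrite /velocity tangent_map_hat // -/(w t) -/(v t) -/(u t) -w'E // dpi_w'.
  split=> // [t It|]; first exact: contact_element_hat (hN t It) (c0 t It).
  exists (fun t => c t *: hat (q t)); split; last first.
    move=> t x It; have [q0 _] := inM_neq0 (hN t It).
    by rewrite tangent_map_hat // -scalemxAl linearZ /= mul_hat.
  (* The entries of [c *: hat q] are rational in the coordinates of [q], [p] and their derivatives;
     the denominators [pairing p q] and [pairing u u^T] do not vanish on [I]. *)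
  have leaf m n (M : R -> 'M[R]_(m, n)) i j :
      smooth_on I M -> smooth_expr I (fun t => M t i j).
    by move=> /(smooth_on_mxP oI) sM; exact: SmoothLeaf.
  have sqi i : smooth_expr I (fun t => q t i 0) by exact: leaf.
  have spi i : smooth_expr I (fun t => p t 0 i) by exact: leaf.
  have svi i : smooth_expr I (fun t => v t i 0).
    by apply: leaf; exact: smooth_on_derive1.
  have swi i : smooth_expr I (fun t => w t 0 i).
    by apply: leaf; exact: smooth_on_derive1.
  have eqS f h : f =1 h -> smooth_expr I f -> smooth_expr I h.
    by move=> /funext ->.
  have sub f h : smooth_expr I f -> smooth_expr I h -> smooth_expr I (fun t => f t - h t).
    move=> sf sh; apply: (eqS (f \+ (fun t => (-1) * h t))).
      by move=> t /=; rewrite mulN1r.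
    by apply: SmoothAdd => //; apply: SmoothMul => //; exact: smooth_expr_cst.
  have spairing (a : R -> 'rV[R]_3) (b : R -> 'cV[R]_3) :
      (forall i, smooth_expr I (fun t => a t 0 i)) ->
      (forall i, smooth_expr I (fun t => b t i 0)) ->
      smooth_expr I (fun t => pairing (a t) (b t)).
    move=> sa sb; apply: eqS => [t|]; first by rewrite pairing3; reflexivity.
    by do 2?apply: SmoothAdd; apply: SmoothMul.
  have scross (x y : R -> 'cV[R]_3) :
      (forall i, smooth_expr I (fun t => x t i 0)) ->
      (forall i, smooth_expr I (fun t => y t i 0)) ->
      forall i, smooth_expr I (fun t => crossv (x t) (y t) 0 i).
    move=> sx sy i; apply: eqS => [t|]; first by rewrite mxE; reflexivity.
    by apply: sub; apply: SmoothMul.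
  have su i : smooth_expr I (fun t => u t 0 i) by exact: scross.
  have suT i : smooth_expr I (fun t => (u t)^T i 0).
    by apply: eqS (su i) => t; rewrite [RHS]mxE.
  have sw' i : smooth_expr I (fun t => w' t 0 i).
    apply: (eqS (fun t => w t 0 i - pairing (w t) (q t) *
      (pairing (p t) (q t))^-1 * p t 0 i)) => [t|]; first by rewrite !mxE.
    apply: sub => //; apply: SmoothMul => //; apply: SmoothMul.
      exact: spairing.
    by apply: SmoothInv; [exact: hN|exact: spairing].
  have sc : smooth_expr I c.
    apply: SmoothMul; first exact: spairing.
    apply: SmoothInv; last exact: spairing.
    move=> t It; apply/eqP => /pairing_tr_eq0/eqP; apply/negP.
    by have [qm _] := mv t It; exact: crossv_neq0 (hN t It) qm.
  apply/(smooth_on_mxP oI) => i j; apply: smooth_expr_on => //.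
  apply: (eqS (fun t => c t * crossv (q t) (delta_mx j 0) 0 i)) => [t|].
    by rewrite !mxE.
  apply: SmoothMul => //; apply: scross => // k; exact: smooth_expr_cst.
- rewrite nullP; split=> h t It; first by move=> _ _; exact: h.
  have [qs|qm] := pselect (dpi (q t) (v t) = dpi (q t) 0).
    by apply: incident_still (hN t It) _; left.
  have [ps|pm] := pselect (dpi (p t) (w t) = dpi (p t) 0).
    by apply: incident_still (hN t It) _; right.
  exact: h.
Qed.
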